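(* Let $\bar x\in\mathbb{R}^n$ be a feasible point of the problem (MPCC). Suppose that $\bar x$ is an $A_\alpha$-stationary point of (MPCC) for all $\alpha\in\{0,1\}^p$. Then $\bar x$ is a $P_\alpha$-stationary point of (MPCC) for all $\alpha\in\{0,1\}^p$. In particular, if $\bar x$ is a local minimizer of (MPCC) that satisfies MPCC-GCQ, then $\bar x$ is $P_\alpha$-stationary for all $\alpha\in\{0,1\}^p$.
   Context: Let $f:\mathbb{R}^n\to\mathbb{R}$, $g:\mathbb{R}^n\to\mathbb{R}^l$, $h:\mathbb{R}^n\to\mathbb{R}^m$, $G,H:\mathbb{R}^n\to\mathbb{R}^p$ be differentiable functions. The mathematical program with complementarity constraints (MPCC) is: minimize $f(x)$ over $x\in\mathbb{R}^n$ subject to $g(x)\le 0$, $h(x)=0$, $G(x)\ge 0$, $H(x)\ge 0$, $G(x)^\top H(x)=0$ (inequalities componentwise). Index sets: $I^l=\{1,\dots,l\}$, $I^m=\{1,\dots,m\}$, $I^p=\{1,\dots,p\}$, $I^g(x)=\{i\in I^l: g_i(x)=0\}$, $I^{+0}(x)=\{i\in I^p: G_i(x)>0, H_i(x)=0\}$, $I^{0+}(x)=\{i\in I^p: G_i(x)=0, H_i(x)>0\}$, $I^{00}(x)=\{i\in I^p: G_i(x)=0, H_i(x)=0\}$, and for $\alpha\in\{0,1\}^p$ and $c\in\{0,1\}$, $I^{00}_{\alpha=c}(x)=\{i\in I^{00}(x): \alpha_i=c\}$. Weak stationarity: multipliers $\bar\lambda\in\mathbb{R}^l$, $\bar\eta\in\mathbb{R}^m$,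 $\bar\mu,\bar\nu\in\mathbb{R}^p$ satisfy the system of weak stationarity at a feasible point $\bar x$ of (MPCC) if $$\nabla f(\bar x)+\sum_{i\in I^l}\bar\lambda_i\nabla g_i(\bar x)+\sum_{i\in I^m}\bar\eta_i\nabla h_i(\bar x)-\sum_{i\in I^p}\bar\mu_i\nabla G_i(\bar x)-\sum_{i\in I^p}\bar\nu_i\nabla H_i(\bar x)=0,$$ $\bar\lambda_i\ge 0$ for $i\in I^g(\bar x)$, $\bar\lambda_i=0$ for $i\in I^l\setminus I^g(\bar x)$, $\bar\mu_i=0$ for $i\in I^{+0}(\bar x)$, $\bar\nu_i=0$ for $i\in I^{0+}(\bar x)$. For $\alpha\in\{0,1\}^p$, a feasible point $\bar x$ is called - $A_\alpha$-stationary if there exist multipliers satisfying the system of weak stationarity together with $\bar\mu_i\ge 0$ for all $i\in I^{00}_{\alpha=0}(\bar x)$ and $\bar\nu_i\ge 0$ for all $i\in I^{00}_{\alpha=1}(\bar x)$; - $P_\alpha$-stationary if there exist multipliers satisfying the system of weak stationarity together with $(\bar\mu_i\ge 0\wedge\bar\nu_i\ge 0)\vee\bar\mu_i=0$ for all $i\in I^{00}_{\alpha=0}(\bar x)$ and $(\bar\mu_i\ge 0\wedge\bar\nu_i\ge 0)\vee\bar\nu_i=0$ for all $i\in I^{00}_{\alpha=1}(\bar x)$. Constraint qualification: the tangent cone to a closed set $F\subset\mathbb{R}^n$ at $\bar x\in F$ is the set of all $d\in\mathbb{R}^n$ for which there are sequences $(x_k)\subset F$, $(t_k)\subset(0,\infty)$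 with $x_k\to\bar x$, $t_k\downarrow 0$, $t_k^{-1}(x_k-\bar x)\to d$. Let $\mathcal{T}_{\rm MPCC}(\bar x)$ be the tangent cone to the feasible set of (MPCC) at $\bar x$, and let $\mathcal{T}_{\rm MPCC}^{\rm lin}(\bar x)$ be the set of all $d\in\mathbb{R}^n$ with $\nabla g_i(\bar x)^\top d\le 0$ for $i\in I^g(\bar x)$; $\nabla h_i(\bar x)^\top d=0$ for $i\in I^m$; $\nabla G_i(\bar x)^\top d=0$ for $i\in I^{0+}(\bar x)$; $\nabla H_i(\bar x)^\top d=0$ for $i\in I^{+0}(\bar x)$; and $\nabla G_i(\bar x)^\top d\ge 0$, $\nabla H_i(\bar x)^\top d\ge 0$, $(\nabla G_i(\bar x)^\top d)(\nabla H_i(\bar x)^\top d)=0$ for $i\in I^{00}(\bar x)$. The polar cone of $C\subset\mathbb{R}^n$ is $C^\circ=\{d\in\mathbb{R}^n: d^\top y\le 0\ \forall y\in C\}$. A feasible point $\bar x$ satisfies MPCC-GCQ if $\mathcal{T}_{\rm MPCC}(\bar x)^\circ=\mathcal{T}_{\rm MPCC}^{\rm lin}(\bar x)^\circ$. *)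

(* Defs.v *)
From HB Require Import structures.
From mathcomp Require Import all_boot all_order all_algebra.
From mathcomp Require Import all_classical all_reals all_analysis.

Set Implicit Arguments.
Unset Strict Implicit.
Unset Printing Implicit Defensive.

Import Order.TTheory GRing.Theory Num.Theory.
Import numFieldNormedType.Exports.

Local Open Scope classical_set_scope.
Local Open Scope ring_scope.

(* Points of R^n are row vectors [x : 'rV[R]_n], with coordinates [x 0 i]; the
   library topology on them (given by the sup norm) is the usual one. *)

Definition dotmul (R : realType) (n : nat) (u v : 'rV[R]_n) : R :=
  \sum_(i < n) u 0 i * v 0 i.

Definition gradient (R : realType) (n : nat) (f : 'rV[R]_n -> R)
    (x : 'rV[R]_n) : 'rV[R]_n :=
  \row_(j < n) 'D_(delta_mx 0 j) f x.

(* Gradient of the i-th component function of a vector-valued map. *)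
Definition gradientc (R : realType) (n k : nat) (F : 'rV[R]_n -> 'rV[R]_k)
    (i : 'I_k) (x : 'rV[R]_n) : 'rV[R]_n :=
  gradient (fun y => F y 0 i) x.

(* As usual for tangent cones, [t_k \downarrow 0] means that the positive
   sequence [t] tends to 0; monotonicity is not required. *)
Definition tangent_cone (R : realType) (n : nat) (F : set 'rV[R]_n)
    (x : 'rV[R]_n) : set 'rV[R]_n :=
  [set d | exists (u : nat -> 'rV[R]_n) (t : nat -> R),
    [/\ (forall k, F (u k)) /\ (forall k, 0 < t k),
        u k @[k --> \oo] --> x,
        t k @[k --> \oo] --> (0 : R) &
        (t k)^-1 *: (u k - x) @[k --> \oo] --> d]].

Definition polar_cone (R : realType) (n : nat) (C : set 'rV[R]_n) :
    set 'rV[R]_n :=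
  [set d | forall y, C y -> dotmul d y <= 0].

(* Minimize f subject to g <= 0, h = 0, G >= 0, H >= 0, G^T H = 0.  The
   functions are arbitrary here; differentiability is [mpcc_differentiable]. *)
Record mpcc (R : realType) (n l m p : nat) := MPCC {
  mpcc_f : 'rV[R]_n -> R ;
  mpcc_g : 'rV[R]_n -> 'rV[R]_l ;
  mpcc_h : 'rV[R]_n -> 'rV[R]_m ;
  mpcc_G : 'rV[R]_n -> 'rV[R]_p ;
  mpcc_H : 'rV[R]_n -> 'rV[R]_p
}.

Section MPCC.
Context {R : realType} {n l m p : nat}.
Variable P : mpcc R n l m p.

Local Notation f := (mpcc_f P).
Local Notation g := (mpcc_g P).
Local Notation h := (mpcc_h P).
Local Notation G := (mpcc_G P).
Local Notation H := (mpcc_H P).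

Implicit Types (x d : 'rV[R]_n) (alpha : {ffun 'I_p -> bool}).

Definition mpcc_differentiable : Prop :=
  forall x, [/\ differentiable f x, differentiable g x, differentiable h x,
                differentiable G x & differentiable H x].

Definition feasible : set 'rV[R]_n :=
  [set x | [/\ forall i, g x 0 i <= 0,
               forall i, h x 0 i = 0,
               forall i, 0 <= G x 0 i,
               forall i, 0 <= H x 0 i &
               dotmul (G x) (H x) = 0]].

Definition local_minimizer x : Prop :=
  feasible x /\ \forall y \near x, feasible y -> f x <= f y.

Definition Ig x : {set 'I_l} := [set i | g x 0 i == 0]%SET.
Definition Ip0 x : {set 'I_p} := [set i | (0 < G x 0 i) && (H x 0 i == 0)]%SET.
Definition I0p x : {set 'I_p} := [set i | (G x 0 i == 0) && (0 < H x 0 i)]%SET.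
Definition I00 x : {set 'I_p} := [set i | (G x 0 i == 0) && (H x 0 i == 0)]%SET.

(* Elements of {0,1}^p are boolean vectors: 0 is [false] and 1 is [true]. *)
Definition I00a alpha (c : bool) x : {set 'I_p} :=
  [set i in I00 x | alpha i == c]%SET.

Definition weak_stationarity x (lambda : 'rV[R]_l) (eta : 'rV[R]_m)
    (mu nu : 'rV[R]_p) : Prop :=
  [/\ gradient f x + \sum_(i < l) lambda 0 i *: gradientc g i x
        + \sum_(i < m) eta 0 i *: gradientc h i x
        - \sum_(i < p) mu 0 i *: gradientc G i x
        - \sum_(i < p) nu 0 i *: gradientc H i x = 0,
      forall i, i \in Ig x -> 0 <= lambda 0 i,
      forall i, i \notin Ig x -> lambda 0 i = 0,
      forall i, i \in Ip0 x -> mu 0 i = 0 &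
      forall i, i \in I0p x -> nu 0 i = 0].

Definition A_stationary alpha x : Prop :=
  feasible x /\
  exists lambda eta mu nu,
    [/\ weak_stationarity x lambda eta mu nu,
        forall i, i \in I00a alpha false x -> 0 <= mu 0 i &
        forall i, i \in I00a alpha true x -> 0 <= nu 0 i].

Definition P_stationary alpha x : Prop :=
  feasible x /\
  exists lambda eta mu nu,
    [/\ weak_stationarity x lambda eta mu nu,
        forall i, i \in I00a alpha false x ->
          (0 <= mu 0 i /\ 0 <= nu 0 i) \/ mu 0 i = 0 &
        forall i, i \in I00a alpha true x ->
          (0 <= mu 0 i /\ 0 <= nu 0 i) \/ nu 0 i = 0].

Definition linearized_cone x : set 'rV[R]_n :=
  [set d |
    [/\ forall i, i \in Ig x -> dotmul (gradientc g i x) d <= 0,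
        forall i, dotmul (gradientc h i x) d = 0,
        forall i, i \in I0p x -> dotmul (gradientc G i x) d = 0,
        forall i, i \in Ip0 x -> dotmul (gradientc H i x) d = 0 &
        forall i, i \in I00 x ->
          [/\ 0 <= dotmul (gradientc G i x) d,
              0 <= dotmul (gradientc H i x) d &
              dotmul (gradientc G i x) d * dotmul (gradientc H i x) d = 0]]].

Definition MPCC_GCQ x : Prop :=
  feasible x /\
  polar_cone (tangent_cone feasible x) = polar_cone (linearized_cone x).

End MPCC.

(* Main.v *)
Require Import Defs.
From HB Require Import structures.
From mathcomp Require Import all_boot all_order all_algebra all_fingroup.
From mathcomp Require Import all_classical all_reals all_analysis.
From mathcomp Require Import ring zify.

(* Let [M beta] be multipliers witnessing A_beta-stationarity and interpolate
   them multilinearly over the cube [0,1]^p, so that [M beta] sits at the vertex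
   [beta].  Weak stationarity is a convex condition, hence holds on the whole
   cube; moreover [mu_i >= 0] on the face [x_i = 0] and [nu_i >= 0] on the face
   [x_i = 1].  The condition required of [(mu_i, nu_i)] by P_alpha-stationarity
   is the vanishing of a continuous function of [(mu_i, nu_i)] which has opposite
   signs on these two faces, so the Poincare-Miranda theorem gives a point of the
   cube where all the conditions hold at once.

   The Poincare-Miranda theorem comes from a discrete degree.  On the grid
   {0,..,k}^n, sum over all simplices of the Freudenthal triangulation the signed
   cup product of the coboundaries of [f_0, .., f_(n-1)].  By a discrete Stokes
   formula the sum does not change if [f_j] is modified away from the faces
   [x_j = 0] and [x_j = k], provided each [f_i] is constant on its two faces.  So
   if [f_j] vanishes on the first and is [k] on the second, the sum is the one
   for [f_j = x_j], namely [k ^ n], and some simplex has nonzero contribution: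
   every [f_j] changes its value on it.

   For a local minimizer satisfying MPCC-GCQ, A_beta-stationarity is Farkas' lemma
   on the branch of the linearized cone selected by [beta]. *)

Set Implicit Arguments.
Unset Strict Implicit.
Unset Printing Implicit Defensive.

Import Order.TTheory GRing.Theory Num.Theory.
Import numFieldNormedType.Exports.

Local Open Scope classical_set_scope.
Local Open Scope ring_scope.

(** * Discrete degree *)

(* Vertex [r] of the simplex of the Freudenthal triangulation based at [z] whose
   coordinate [i] is incremented at step [s i]. *)
Definition path_pt (n : nat) (z : 'I_n -> nat) (s : 'S_n) (r : nat) : 'I_n -> nat :=
  fun i => (z i + (s i < r))%N.

(** The functions take arbitrary [nat]-valued points, so no bounds are carried along; base points
    below [k] keep every vertex in the grid {0,..,k}^n. *)
Definition degree_sum (n k : nat) (f : 'I_n -> ('I_n -> nat) -> int) : int :=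
  \sum_(z : {ffun 'I_n -> 'I_k}) \sum_(s : 'S_n) (-1) ^+ s *
    \prod_(i < n) (f i (path_pt (fun c => z c) s i.+1) - f i (path_pt (fun c => z c) s i)).

(* Swapping the two steps around vertex [r] changes only that vertex and the
   sign of [s]. *)
Lemma alternating_sum_eq0 (n : nat) (z : 'I_n -> nat) (r : nat) (Phi : 'S_n -> int) :
  (0 < r < n)%N ->
  (forall s s', (forall q, q != r -> path_pt z s q = path_pt z s' q) -> Phi s = Phi s') ->
  \sum_(s : 'S_n) (-1) ^+ s * Phi s = 0.
Proof.
move=> /andP[r0 rn] PhiE.
have r1n : (r.-1 < n)%N by lia.
(* The test [s i < q] separates the values [r.-1] and [r] only for [q = r]. *)
pose a := Ordinal r1n; pose b := Ordinal rn.
have ab : a != b by apply/eqP => /(congr1 val) /=; lia.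
set S := LHS; suff : S = - S by lia.
rewrite {1}/S (reindex_inj (mulIg (tperm a b))) /= -sumrN; apply: eq_bigr => s _.
rewrite odd_permM odd_tperm ab signr_addb /= expr1 mulrN1 mulNr.
congr (- (_ * _)); apply: PhiE => q qr; apply: funext => i; rewrite /path_pt permM.
by case: tpermP => [->|->|//]; congr (_ + nat_of_bool _)%N; rewrite /=; lia.
Qed.

(** Shifting coordinate [c] cyclically matches the terms except where [z c = k - 1]; there one side
    reaches [k], the other wraps to 0, and [h] vanishes at both. *)
Lemma cyclic_shift_sum (n k : nat) (h : ('I_n -> nat) -> int) (c : 'I_n) :
  (forall y : 'I_n -> nat, y c = 0%N \/ y c = k -> h y = 0) ->
  \sum_(z : {ffun 'I_n -> 'I_k}) h (fun i => z i + (i == c))%N =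
  \sum_(z : {ffun 'I_n -> 'I_k}) h (fun i => z i).
Proof.
move=> h0.
pose shift (z : {ffun 'I_n -> 'I_k}) := [ffun i => if i == c then ordS (z i) else z i].
have shiftI : injective shift.
  move=> z z' /ffunP e; apply/ffunP => i; have := e i; rewrite !ffunE.
  by case: eqP => // _ /(can_inj (@ordSK k)).
rewrite [RHS](reindex_inj shiftI) /=; apply: eq_bigr => z _.
have := ltn_ord (z c); rewrite leq_eqVlt => /predU1P[zk|zk].
- rewrite !h0 //; first by left; rewrite ffunE eqxx /= zk modnn.
  by right; rewrite eqxx addn1.
- congr h; apply: funext => i; rewrite ffunE; case: eqP => [->|_] /=; last by rewrite addn0.
  by rewrite addn1 modn_small.
Qed.

(** * Discrete Stokes formula *)

Section Degree.
Variables (n k : nat) (f : 'I_n.+1 -> ('I_n.+1 -> nat) -> int) (j : 'I_n.+1).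
Let P (z : {ffun 'I_n.+1 -> 'I_k}) s r := path_pt (fun c => z c) s r.

(* The functions other than [f j] are differenced along the edges of the path
   other than the [g]-th one, in order, and [f j] is evaluated at vertex [v]. *)
Let cup (z : 'I_n.+1 -> nat) (s : 'S_n.+1) (g v : nat) : int :=
  f j (path_pt z s v) *
  \prod_(t < n) (f (lift j t) (path_pt z s (bump g t).+1)
                 - f (lift j t) (path_pt z s (bump g t))).
Let gap_sum (g v : nat) : int :=
  \sum_(z : {ffun 'I_n.+1 -> 'I_k}) \sum_(s : 'S_n.+1) (-1) ^+ s * cup (fun c => z c) s g v.

Let degree_gap : degree_sum k f = gap_sum j j.+1 - gap_sum j j.
Proof.
rewrite /degree_sum /gap_sum -sumrB; apply: eq_bigr => z _; rewrite -sumrB; apply: eq_bigr => s _.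
by rewrite (bigD1_ord j) //= /cup -mulrBr -mulrBl.
Qed.

(** In the sum of the two cup products, the factors of [lift j g] telescope to a difference between
    vertices [g] and [g.+2]. Vertex [g.+1] no longer occurs, so the alternating sum vanishes. *)
Let gap_slide (g v : nat) : (g < n)%N -> v != g.+1 -> gap_sum g v = - gap_sum g.+1 v.
Proof.
move=> gn vg; apply/eqP; rewrite -subr_eq0 opprK; apply/eqP.
rewrite /gap_sum -big_split big1 //= => z _; rewrite -big_split /=.
under eq_bigr do rewrite -mulrDr.
apply: (@alternating_sum_eq0 _ (fun c => z c) g.+1) => // s s' e.
pose t0 := Ordinal gn.
have E s0 : cup (fun c => z c) s0 g v + cup (fun c => z c) s0 g.+1 v =
  f j (P z s0 v) * ((f (lift j t0) (P z s0 g.+2) - f (lift j t0) (P z s0 g)) *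
    \prod_(t < n | t != t0) (f (lift j t) (P z s0 (bump g t).+1)
                 - f (lift j t) (P z s0 (bump g t)))).
  rewrite /cup -mulrDr; congr (_ * _).
  rewrite (bigD1 t0) //= [X in _ + X](bigD1 t0) //=.
  have -> : bump g g = g.+1 by rewrite /bump leqnn.
  have -> : bump g.+1 g = g by rewrite /bump ltnn.
  have -> : \prod_(t < n | t != t0) (f (lift j t) (path_pt (fun c => z c) s0 (bump g.+1 t).+1)
                 - f (lift j t) (path_pt (fun c => z c) s0 (bump g.+1 t))) =
      \prod_(t < n | t != t0) (f (lift j t) (P z s0 (bump g t).+1)
                 - f (lift j t) (P z s0 (bump g t))).
    apply: eq_bigr => t tt0; suff -> : bump g.+1 t = bump g t by [].
    by have tg : (t : nat) != g := tt0; rewrite /bump; lia.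
  by rewrite -mulrDl /P; congr (_ * _); ring.
rewrite !E /P (e v) // (e g.+2) ?(e g); [|lia..].
do 2 congr (_ * _); apply: eq_bigr => t tt0.
by have tg : (t : nat) != g := tt0; rewrite !e // /bump; lia.
Qed.

(* Rotating [s] identifies the face opposite to the first vertex with the face
   opposite to the last vertex of a translated simplex. *)
Let gap_first_last : (j <= n)%N ->
  (forall i y y', i != j -> y i = y' i -> y i = 0%N \/ y i = k -> f i y = f i y') ->
  (forall y, y j = 0%N \/ y j = k -> f j y = 0) ->
  gap_sum 0 j.+1 = (-1) ^+ n * gap_sum n j.
Proof.
move=> jn f_face fj0.
(* The cycle sending [n] to 0 and every other [t] to [t + 1]. *)
pose rho : 'S_n.+1 := lift_perm ord_max ord0 1.
have oddr : odd_perm rho = odd n by rewrite odd_lift_perm odd_perm1 /= !addbF.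
rewrite /gap_sum exchange_big [X in _ * X]exchange_big mulr_sumr /=.
rewrite (reindex_inj (mulIg rho)) /=; apply: eq_bigr => s _.
rewrite -!mulr_sumr odd_permM oddr signr_addb signr_odd mulrA [_ * (-1) ^+ n]mulrC.
congr (_ * _).
pose c := (s^-1)%g ord_max.
have sc : s c = ord_max by rewrite permKV.
(* Coordinate [c] is incremented last, so it is constant on all vertices but the last. Where it is 0
   or [k], either the factor of [f c] is a difference of equal values, or [c = j] and [f j]
   vanishes. *)
rewrite -(@cyclic_shift_sum _ _ (fun y => cup y s n j) c); last first.
  move=> y yc; have Pc q : (q <= n)%N -> path_pt y s q c = y c.
    by move=> qn; rewrite /path_pt sc /= ltnNge qn addn0.
  rewrite /cup; case: (unliftP j c) => [t ct|cj]; last by rewrite fj0 ?mul0r // -{2 4}cj Pc.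
  have tn := ltn_ord t; have bt : bump n t = t by rewrite /bump; lia.
  rewrite (bigD1 t) //= bt -ct (f_face c _ (path_pt y s t)) ?subrr ?mul0r ?mulr0 //.
  - by rewrite ct eq_sym neq_lift.
  - by rewrite !Pc // ltnW.
  - by rewrite Pc.
apply: eq_bigr => z _.
have PE q : (q <= n)%N -> path_pt (fun i => z i) (s * rho) q.+1
    = path_pt (fun i => z i + (i == c))%N s q.
  move=> qn; apply: funext => i; rewrite /path_pt permM -addnA; congr (_ + _)%N.
  case: (unliftP ord_max (s i)) => [t st|st].
    rewrite st lift_perm_lift perm1 /=.
    have -> : i == c = false by apply/eqP => ic; have := neq_lift ord_max t; rewrite -st ic sc eqxx.
    by rewrite /bump /=; have := ltn_ord t; lia.
  have -> : i == c by apply/eqP; apply: (@perm_inj _ s); rewrite sc.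
  by rewrite st lift_perm_id /=; lia.
rewrite /cup PE //; congr (_ * _); apply: eq_bigr => t _.
have tn := ltn_ord t; have -> : bump n t = t by rewrite /bump; lia.
by rewrite /bump /= add1n !PE //; lia.
Qed.

(** Splitting the factor of [f j] leaves a gap at edge [j]. With vertex [j] the gap slides up to
    [n], with vertex [j.+1] down to 0, never meeting the vertex; rotation identifies the two
    results, and the signs make them cancel. *)
Lemma degree_sum_eq0 :
  (forall i y y', i != j -> y i = y' i -> y i = 0%N \/ y i = k -> f i y = f i y') ->
  (forall y, y j = 0%N \/ y j = k -> f j y = 0) ->
  degree_sum k f = 0.
Proof.
move=> f_face fj0; have jn : (j <= n)%N by rewrite -ltnS.
have slide_up q : (j <= q <= n)%N -> gap_sum j j = (-1) ^+ (q - j) * gap_sum q j.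
  elim: q => [|q IH] jq.
    have j0 : j = 0%N :> nat by lia.
    by rewrite j0 mul1r.
  have [jq'|jq'] := ltnP q j.
    have jq1 : j = q.+1 :> nat by lia.
    by rewrite jq1 subnn mul1r.
  rewrite IH; last by lia.
  rewrite gap_slide; [|lia..].
  by rewrite subSn // exprS; ring.
have slide_down q : (q <= j)%N -> gap_sum 0 j.+1 = (-1) ^+ q * gap_sum q j.+1.
  elim: q => [|q IH] qj; first by rewrite mul1r.
  rewrite IH; last by lia.
  rewrite gap_slide; [|lia..].
  by rewrite exprS; ring.
rewrite degree_gap (slide_up n) ?jn ?leqnn //.
have -> : gap_sum j j.+1 = (-1) ^+ j * gap_sum 0 j.+1.
  by rewrite (slide_down j) // mulrA -exprMn mulrNN mulr1 expr1n mul1r.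
rewrite gap_first_last // mulrA -exprD.
have -> : (j + n = (n - j) + (j + j))%N by lia.
by rewrite exprD addnn -mul2n exprM sqrrN !expr1n mulr1 subrr.
Qed.
End Degree.

Lemma degree_sumB n k (f f' h : 'I_n -> ('I_n -> nat) -> int) (j : 'I_n) :
  (forall i, i != j -> f i = f' i /\ f i = h i) ->
  (forall y, h j y = f j y - f' j y) ->
  degree_sum k f - degree_sum k f' = degree_sum k h.
Proof.
move=> E Ej; rewrite -sumrB; apply: eq_bigr => z _; rewrite -sumrB; apply: eq_bigr => s _.
rewrite -mulrBr; congr (_ * _).
rewrite (bigD1 j) //= [X in _ - X](bigD1 j) //= [RHS](bigD1 j) //= !Ej.
under [X in _ - _ * X]eq_bigr => i ij do rewrite -(E i ij).1.
under [X in _ = _ * X]eq_bigr => i ij do rewrite -(E i ij).2.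
by ring.
Qed.

(** The factor of [i] is 1 if [s i = i] and 0 otherwise, so only the identity permutation
    contributes. *)
Lemma degree_sum_id n k : degree_sum k (fun (i : 'I_n) y => (y i)%:Z) = (k ^ n)%:Z.
Proof.
rewrite /degree_sum (eq_bigr (fun=> 1)) => [|z _].
  by rewrite sumr_const card_ffun !card_ord natz.
rewrite (bigD1 1%g) //= [X in _ + X]big1 ?addr0 => [|s s1].
  rewrite odd_perm1 mul1r big1 // => i _; rewrite /path_pt perm1 ltnS leqnn ltnn; lia.
have [i si|sid] := pickP (fun i => s i != i); last first.
  by case/eqP: s1; apply/permP => i; rewrite perm1; have /negbFE/eqP := sid i.
rewrite (bigD1 i) //= /path_pt.
have : val (s i) != val i by []. 
rewrite ltnS leq_eqVlt => /negbTE -> /=; by rewrite subrr mul0r mulr0.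
Qed.

(** The functions are replaced by the coordinates one at a time; each change in degree is the degree
    of a family whose [j]-th function vanishes on its two faces. *)
Lemma degree_sum_normalized n k (f : 'I_n -> ('I_n -> nat) -> int) :
  (forall i y, y i = 0%N \/ y i = k -> f i y = (y i)%:Z) ->
  degree_sum k f = (k ^ n)%:Z.
Proof.
rewrite -degree_sum_id; case: n f => [|n] f ff.
  by congr degree_sum; apply: funext => -[].
pose F t (i : 'I_n.+1) y : int := if (i < t)%N then (y i)%:Z else f i y.
have F_face t i y : y i = 0%N \/ y i = k -> F t i y = (y i)%:Z by rewrite /F; case: ifP => // _ /ff.
have step t : (t < n.+1)%N -> degree_sum k (F t) = degree_sum k (F t.+1).
  move=> tn; pose j := Ordinal tn.
  pose h (i : 'I_n.+1) y := if i == j then F t i y - F t.+1 i y else F t i y.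
  apply/eqP; rewrite -subr_eq0; rewrite (@degree_sumB _ _ _ _ h j).
  - apply/eqP; apply: (@degree_sum_eq0 _ _ _ j).
      move=> i y y' ij yy' yi; rewrite /h (negbTE ij) !F_face // -?yy' //; by rewrite yy'.
    by move=> y yj; rewrite /h eqxx !F_face // subrr.
  - move=> i ij; split; last by rewrite /h (negbTE ij).
    apply: funext => y; rewrite /F; have : val i != t by [].
    by rewrite ltnS [(i <= t)%N]leq_eqVlt => /negbTE->.
  - by move=> y; rewrite /h eqxx.
have steps t : (t <= n.+1)%N -> degree_sum k (F 0%N) = degree_sum k (F t).
  by elim: t => // t IH tn; rewrite IH 1?ltnW // step.
rewrite -[f]/(F 0%N) (steps n.+1) //; congr degree_sum; apply: funext => i; apply: funext => y.
by rewrite /F ltn_ord.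
Qed.

Lemma sumr_neq0 (I : finType) (V : nmodType) (F : I -> V) :
  \sum_i F i != 0 -> exists i, F i != 0.
Proof.
move=> Fn0; have [i Fi|F0] := pickP (fun i => F i != 0); first by exists i.
by move: Fn0; rewrite big1 ?eqxx // => i _; apply/eqP/negbFE/F0.
Qed.

Lemma discrete_poincare_miranda n k (L : 'I_n -> ('I_n -> nat) -> bool) :
  (0 < k)%N ->
  (forall i y, y i = 0%N -> ~~ L i y) -> (forall i y, y i = k -> L i y) ->
  exists2 z : 'I_n -> nat, forall i, (z i < k)%N &
  forall i, exists y y', [/\ L i y, ~~ L i y',
    forall c, (z c <= y c <= (z c).+1)%N & forall c, (z c <= y' c <= (z c).+1)%N].
Proof.
move=> k0 L0 Lk.
(* The value is [k], not 1, so that [f i] agrees with the coordinate on both faces. *)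
pose f i y : int := if L i y then k%:Z else 0.
have fW : degree_sum k f != 0.
  rewrite degree_sum_normalized; first by rewrite lt0r_neq0 // ltz_nat expn_gt0 k0.
  by move=> i y [] yi; rewrite /f yi; [rewrite (negbTE (L0 _ _ yi))|rewrite Lk].
have [z0 fz] := sumr_neq0 fW.
pose z i := nat_of_ord (z0 i); exists z => [i|i]; first exact: ltn_ord.
have [s] := sumr_neq0 fz; rewrite mulf_eq0 negb_or => /andP[_ /prodf_neq0/(_ i isT)].
have Pb r c : (z c <= path_pt z s r c <= (z c).+1)%N.
  by rewrite /path_pt; case: (_ < r)%N; lia.
rewrite -/(f i _) -/z /f.
case La: (L i (path_pt _ s i.+1)); case Lb: (L i (path_pt _ s i)); rewrite ?subrr ?eqxx // => _.
- by exists (path_pt z s i.+1), (path_pt z s i); rewrite Lb.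
- by exists (path_pt z s i), (path_pt z s i.+1); rewrite La.
Qed.

(** * The Poincare-Miranda theorem *)

Definition unit_cube (R : realType) (n : nat) : set 'rV[R]_n :=
  [set x | forall i, `[0, 1]%classic (x 0 i)].

Lemma approximate_poincare_miranda (R : realType) (n : nat) (F : 'I_n -> 'rV[R]_n -> R) (N : nat) :
  (forall i x, unit_cube x -> x 0 i = 0 -> 0 <= F i x) ->
  (forall i x, unit_cube x -> x 0 i = 1 -> F i x <= 0) ->
  exists2 a, unit_cube a & forall i, exists b b', [/\ F i b <= 0, 0 <= F i b',
    forall c, `|a 0 c - b 0 c| <= N.+1%:R^-1 & forall c, `|a 0 c - b' 0 c| <= N.+1%:R^-1].
Proof.
move=> F0 F1.
pose pt (y : 'I_n -> nat) : 'rV[R]_n := \row_i ((y i)%:R / N.+1%:R).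
(* [F i] may vanish on the faces, so the labels there are prescribed; the sign hypotheses give the
   weak inequalities at such points. *)
pose L i y := (y i != 0%N) && ((y i == N.+1) || (F i (pt y) < 0)).
have pt_cube y : (forall i, (y i <= N.+1)%N) -> unit_cube (pt y).
  move=> yN i; rewrite mxE /= in_itv /= divr_ge0 //= ler_pdivrMr ?ltr0n // mul1r ler_nat; exact: yN.
have [|i y yi|i y yi|z zN zP] := @discrete_poincare_miranda n N.+1 L.
- by [].
- by rewrite /L yi.
- by rewrite /L yi eqxx.
exists (pt z); first by apply: pt_cube => i; apply: ltnW.
move=> i; have [y [y' [Ly Ly' zy zy']]] := zP i.
have cubeP y0 : (forall c, (z c <= y0 c <= (z c).+1)%N) -> unit_cube (pt y0).
  by move=> zy0; apply: pt_cube => c; have := zy0 c; have := zN c; lia.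
have near y0 : (forall c, (z c <= y0 c <= (z c).+1)%N) ->
    forall c, `|pt z 0 c - pt y0 0 c| <= N.+1%:R^-1.
  move=> zy0 c; rewrite !mxE -mulrBl normrM [X in _ * X]ger0_norm ?invr_ge0 //.
  rewrite ler_piMl ?invr_ge0 //.
  have [->|->] : y0 c = z c \/ y0 c = (z c).+1 by have := zy0 c; lia.
    by rewrite subrr normr0.
  by rewrite -natr1 opprD addrA subrr sub0r normrN normr1.
exists (pt y), (pt y'); split; [| |exact: near|exact: near].
- case/andP: Ly => _ /orP[/eqP yi|/ltW //]; apply: F1; first exact: cubeP.
  by rewrite mxE yi divff // pnatr_eq0.
- move: Ly'; rewrite /L negb_and negbK => /orP[/eqP yi|].
    by apply: F0; [exact: cubeP|rewrite mxE yi mul0r].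
  by rewrite negb_or -leNgt => /andP[].
Qed.

(** At a cluster point of the approximate solutions, a nonzero [F i] would keep a strict sign
    nearby, but points of both weak signs come arbitrarily close. *)
Lemma poincare_miranda (R : realType) (n : nat) (F : 'I_n -> 'rV[R]_n -> R) :
  (forall i, continuous (F i)) ->
  (forall i x, unit_cube x -> x 0 i = 0 -> 0 <= F i x) ->
  (forall i x, unit_cube x -> x 0 i = 1 -> F i x <= 0) ->
  exists2 x, unit_cube x & forall i, F i x = 0.
Proof.
move=> Fc F0 F1.
have /choice[u uP] N : exists a, unit_cube a /\ forall i, exists b b', [/\ F i b <= 0, 0 <= F i b',
    forall c, `|a 0 c - b 0 c| <= N.+1%:R^-1 & forall c, `|a 0 c - b' 0 c| <= N.+1%:R^-1].
  by have [a ? ?] := approximate_poincare_miranda N F0 F1; exists a.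
have cube_compact : compact (@unit_cube R n).
  by have := @rV_compact R n (fun=> `[0, 1]%classic) (fun=> @segment_compact R 0 1).
have [x [xcube xclus]] : @unit_cube R n `&` cluster (u @ \oo) !=set0.
  by apply: cube_compact; exists 0%N => // N _; exact: (uP N).1.
exists x => // i.
have close (V : set 'rV[R]_n) : nbhs x V -> exists N, forall b : 'rV[R]_n,
    (forall c, `|u N 0 c - b 0 c| <= N.+1%:R^-1) -> V b.
  move=> /nbhs_ballP[e /= e0 eV].
  have e20 : 0 < e / 2 by rewrite divr_gt0.
  have [N0 _ N0P] := near_infty_natSinv_lt (PosNum e20).
  have uN0 : (u @ \oo) (u @` [set N | (N0 <= N)%N]).
    by exists N0 => // N N0N; exists N.
  have [_ [[N N0N <-] xuN]] := xclus _ _ uN0 (nbhsx_ballx x _ e20).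
  exists N => // b ub; apply: eV.
  rewrite (splitr e); apply: ball_triangle xuN _.
  split=> // r c; rewrite ord1; apply: le_lt_trans (ub c) _.
  exact: N0P.
have [Fx|Fx|//] := ltgtP (F i x) 0.
- have [N NV] := close [set y | F i y < 0] (cvgr_lt (F i x) (Fc i x) _ Fx).
  have [b [b' [_ b'0 _ /NV /=]]] := (uP N).2 i; by rewrite ltNge b'0.
- have [N NV] := close [set y | 0 < F i y] (cvgr_gt (F i x) (Fc i x) _ Fx).
  have [b [b' [b0 _ /NV /= + _]]] := (uP N).2 i; by rewrite ltNge b0.
Qed.

(** * Farkas' lemma and first-order conditions *)

Section Dot.
Variables (R : realType) (n : nat).
Implicit Types u v w : 'rV[R]_n.

Lemma dotmulDl u v w : dotmul (u + v) w = dotmul u w + dotmul v w.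
Proof. by rewrite -big_split; apply: eq_bigr => i _; rewrite mxE mulrDl. Qed.

Lemma dotmulZl a v w : dotmul (a *: v) w = a * dotmul v w.
Proof. by rewrite mulr_sumr; apply: eq_bigr => i _; rewrite mxE mulrA. Qed.

Lemma dotmulC u v : dotmul u v = dotmul v u.
Proof. by apply: eq_bigr => i _; rewrite mulrC. Qed.

Lemma dotmulNl v w : dotmul (- v) w = - dotmul v w.
Proof. by rewrite -scaleN1r dotmulZl mulN1r. Qed.

(** If the first [m] inequalities suffice, the last generator gets coefficient 0. Otherwise a
    counterexample [d0] is negative on it, and projecting along [d0] onto its kernel eliminates
    it. *)
Lemma farkas_ord m (a : 'I_m -> 'rV[R]_n) (b : 'rV[R]_n) :
  (forall d, (forall i, 0 <= dotmul (a i) d) -> 0 <= dotmul b d) ->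
  exists2 c : 'I_m -> R, forall i, 0 <= c i & b = \sum_i c i *: a i.
Proof.
elim: m a b => [|m IH] a b ab.
  exists (fun=> 0) => //; rewrite big_ord0.
  (* Testing at [- b] forces [b = 0]. *)
  have := ab (- b) (fun i => False_ind _ (notF (ltn_ord i))).
  rewrite dotmulC dotmulNl oppr_ge0 => bb.
  apply/rowP => i; rewrite mxE; apply/eqP; rewrite -sqrf_eq0 expr2.
  have : dotmul b b == 0.
    by rewrite eq_le bb sumr_ge0 // => j _; rewrite -expr2 sqr_ge0.
  by rewrite psumr_eq0 => [/allP/(_ i)|j _]; rewrite ?mem_index_enum -?expr2 ?sqr_ge0 //; apply.
pose a' i := a (lift ord_max i); pose al := a ord_max.
have [/IH[c c0 ->]|] := pselect (forall d, (forall i, 0 <= dotmul (a' i) d) -> 0 <= dotmul b d).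
  exists (fun i => if unlift ord_max i is Some j then c j else 0).
    by move=> i; case: unliftP => [j _|_]; [exact: c0|exact: lexx].
  rewrite (bigD1_ord ord_max) //= unlift_none scale0r add0r.
  by apply: eq_bigr => i _; rewrite liftK.
move=> /existsNP[d0 /not_implyP[ad0 /negP]]; rewrite -ltNge => bd0.
have ald0 : dotmul al d0 < 0.
  rewrite ltNge; apply/negP => h; move: bd0; rewrite ltNge ab // => i.
  by case: (unliftP ord_max i) => [j ->|->]; [exact: ad0|exact: h].
(* Every functional is corrected by a multiple of [al] so as to vanish at [d0]. *)
pose cor v := v - (dotmul v d0 / dotmul al d0) *: al.
have corE v d : dotmul (cor v) d = dotmul v (d - (dotmul al d / dotmul al d0) *: d0).
  rewrite dotmulDl dotmulNl dotmulZl [RHS]dotmulC dotmulDl dotmulNl dotmulZl.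
  by rewrite !(dotmulC d) !(dotmulC d0); ring.
have [d ad|c c0 bc] := IH (fun i => cor (a' i)) (cor b).
  rewrite corE; apply: ab => i; case: (unliftP ord_max i) => [j|] ->.
    by rewrite -corE; exact: ad.
  rewrite -/al dotmulC dotmulDl dotmulNl dotmulZl !(dotmulC _ al) divfK ?lt_eqF //.
  by rewrite subrr.
(* What remains for [al] once the corrections are undone; it is nonnegative because [b] and [al] are
   negative at [d0] and the other generators are not. *)
pose cl := dotmul b d0 / dotmul al d0 - \sum_i c i * (dotmul (a' i) d0 / dotmul al d0).
exists (fun i => if unlift ord_max i is Some j then c j else cl).
  move=> i; case: unliftP => // _; rewrite /cl subr_ge0; apply: (@le_trans _ _ 0).
    apply: sumr_le0 => j _; rewrite mulr_ge0_le0 // mulr_ge0_le0 // ?ad0 //.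
    by rewrite invr_le0 ltW.
  by rewrite mulr_le0 ?invr_le0 // ltW.
rewrite (bigD1_ord ord_max) //= unlift_none.
under eq_bigr do rewrite liftK -/(a' _).
rewrite -/al /cl scalerBl scaler_suml.
transitivity (cor b + (dotmul b d0 / dotmul al d0) *: al); first by rewrite subrK.
rewrite bc.
have -> : \sum_i c i *: cor (a' i) =
    \sum_i c i *: a' i - \sum_i (c i * (dotmul (a' i) d0 / dotmul al d0)) *: al.
  by rewrite -sumrB; apply: eq_bigr => i _; rewrite scalerBr scalerA.
by rewrite [LHS]addrC [LHS]addrA [RHS]addrAC.
Qed.

Lemma farkas (I : finType) (a : I -> 'rV[R]_n) (b : 'rV[R]_n) :
  (forall d, (forall i, 0 <= dotmul (a i) d) -> 0 <= dotmul b d) ->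
  exists2 c : I -> R, forall i, 0 <= c i & b = \sum_i c i *: a i.
Proof.
move=> ab; have [d ad|c c0 bE] := @farkas_ord #|I| (fun i => a (enum_val i)) b.
  by apply: ab => i; have := ad (enum_rank i); rewrite enum_rankK.
exists (fun i => c (enum_rank i)) => //.
rewrite bE [RHS](reindex _ (onW_bij _ (@enum_val_bij I))) /=.
by apply: eq_bigr => i _; rewrite enum_valK.
Qed.

Lemma dotmul_gradient (f : 'rV[R]_n -> R) (x d : 'rV[R]_n) :
  differentiable f x -> dotmul (gradient f x) d = 'd f x d.
Proof.
move=> fx; rewrite {2}(row_sum_delta d) linear_sum; apply: eq_bigr => i _.
by rewrite linearZ mxE deriveE // mulrC.
Qed.

(** Eventually the derivative at [u k - x] plus [e] times the norm of [u k - x] is nonnegative;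
    divide by [t k], pass to the limit, then let [e] be small. *)
Lemma tangent_cone_first_order (f : 'rV[R]_n -> R) (S : set 'rV[R]_n) (x d : 'rV[R]_n) :
  differentiable f x -> (\forall y \near x, S y -> f x <= f y) ->
  tangent_cone S x d -> 0 <= dotmul (gradient f x) d.
Proof.
move=> fx fmin [u [t [[uS t0] ux _ ud]]].
rewrite dotmul_gradient //.
suff De e : 0 < e -> 0 <= 'd f x d + e * `|d|.
  rewrite leNgt; apply/negP => D0.
  have d1 : 0 < `|d| + 1 by rewrite ltr_wpDl.
  (* With this [e] the sum is ['d f x d] divided by |d| + 1, still negative. *)
  have := De (- 'd f x d / (`|d| + 1)); rewrite divr_gt0 ?oppr_gt0 // => /(_ isT).
  have -> : 'd f x d + - 'd f x d / (`|d| + 1) * `|d| = 'd f x d / (`|d| + 1).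
    by field; rewrite gt_eqF.
  by rewrite pmulr_lge0 ?invr_gt0 // leNgt D0.
move=> e0; pose v k := (t k)^-1 *: (u k - x).
have cv : 'd f x (v k) + e * `|v k| @[k --> \oo] --> 'd f x d + e * `|d|.
  apply: cvgD; last by apply: cvgMl_tmp; exact: cvg_norm.
  by apply: (continuous_cvg _ _ ud); apply: diff_continuous.
rewrite -(cvg_lim _ cv) //; apply: limr_ge; first by apply: cvgP cv.
have ux0 : u k - x @[k --> \oo] --> (0 : 'rV[R]_n).
  by rewrite -[X in _ --> X](subrr x); apply: cvgB => //; exact: cvg_cst.
have fE := diff_locally fx; set o := 'o _ in fE.
have oe : \forall y \near (0 : 'rV[R]_n), `|o y| <= e * `|y|.
  exact: (littleoP [littleo of o]).
near=> k.
have le_f : f x <= f (u k).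
  by move: (uS k); near: k; exact: (ux _ fmin).
have le_o : `|o (u k - x)| <= e * `|u k - x|.
  by near: k; exact: (ux0 _ oe).
have fuk : f (u k) = f x + 'd f x (u k - x) + o (u k - x).
  by have := congr1 (fun F => F (u k - x)) fE; rewrite /= subrK.
rewrite /v linearZ normrZ gtr0_norm ?invr_gt0 // mulrCA -mulrDr.
rewrite pmulr_rge0 ?invr_gt0 //.
move: le_f; rewrite fuk -addrA lerDl => /le_trans; apply.
by rewrite lerD2l; apply: le_trans le_o; exact: ler_norm.
Unshelve. all: by end_near. Qed.
End Dot.

(** * Stationarity *)

Section Multilinear.
Variables (R : realType) (p : nat).
Implicit Types (x : 'rV[R]_p) (beta : {ffun 'I_p -> bool}).

(** The probability of [beta] when its entries are independent and [beta i] is true with probability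
    [x 0 i]. *)
Definition weight x beta : R := \prod_(i < p) (if beta i then x 0 i else 1 - x 0 i).

Lemma weight_sum x : \sum_beta weight x beta = 1.
Proof.
rewrite /weight -(bigA_distr_bigA (fun i (b : bool) => if b then x 0 i else 1 - x 0 i)).
by rewrite big1 // => i _; rewrite big_bool /= addrC subrK.
Qed.

Lemma weight_ge0 x beta : unit_cube x -> 0 <= weight x beta.
Proof.
move=> x01; apply: prodr_ge0 => i _; have /andP[x0 x1] : 0 <= x 0 i <= 1.
  by have := x01 i; rewrite /= in_itv.
by case: ifP => // _; rewrite subr_ge0.
Qed.

(** Only the vertices of a facet carry weight on it, so sign conditions at these vertices pass to
    the whole facet. *)
Lemma weight_eq0 x beta i : x 0 i = (~~ beta i)%:R -> weight x beta = 0.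
Proof.
move=> xi; apply/eqP/prodf_eq0; exists i => //; rewrite xi.
by case: (beta i) => //=; rewrite subrr.
Qed.

Lemma weight_continuous beta : continuous (fun x => weight x beta).
Proof.
apply: (continuous_big (@mul_continuous R)) => i _.
case: (beta i) => x; first exact: coord_continuous.
by apply: (@cvgB _ _ _ (nbhs x)); [exact: cvg_cst|exact: coord_continuous].
Qed.

Definition interpolate q (v : {ffun 'I_p -> bool} -> 'rV[R]_q) x : 'rV[R]_q :=
  \sum_beta weight x beta *: v beta.

Lemma interpolateE q (v : {ffun 'I_p -> bool} -> 'rV[R]_q) x j :
  interpolate v x 0 j = \sum_beta weight x beta * v beta 0 j.
Proof. by rewrite summxE; apply: eq_bigr => b _; rewrite mxE. Qed.

Lemma interpolate_continuous q (v : {ffun 'I_p -> bool} -> 'rV[R]_q) j :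
  continuous (fun x => interpolate v x 0 j).
Proof.
under eq_fun do rewrite interpolateE.
apply: (continuous_big (@add_continuous R)) => b _ x.
by apply: (@cvgMr_tmp _ _ (nbhs x)); exact: weight_continuous.
Qed.

Lemma interpolate_eq0 q (v : {ffun 'I_p -> bool} -> 'rV[R]_q) x j :
  (forall beta, v beta 0 j = 0) -> interpolate v x 0 j = 0.
Proof. by move=> v0; rewrite interpolateE big1 // => b _; rewrite v0 mulr0. Qed.

Lemma interpolate_ge0 q (v : {ffun 'I_p -> bool} -> 'rV[R]_q) x j :
  unit_cube x ->
  (forall beta, weight x beta != 0 -> 0 <= v beta 0 j) -> 0 <= interpolate v x 0 j.
Proof.
move=> x01 v0; rewrite interpolateE; apply: sumr_ge0 => b _.
have [->|w0] := eqVneq (weight x b) 0; first by rewrite mul0r.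
by rewrite mulr_ge0 ?weight_ge0 ?v0.
Qed.

Lemma interpolate_comb q n (v : {ffun 'I_p -> bool} -> 'rV[R]_q) (a : 'I_q -> 'rV[R]_n) x :
  \sum_j interpolate v x 0 j *: a j =
  \sum_beta weight x beta *: \sum_j v beta 0 j *: a j.
Proof.
under eq_bigr do rewrite interpolateE scaler_suml.
rewrite exchange_big; apply: eq_bigr => b _; rewrite scaler_sumr.
by apply: eq_bigr => j _; rewrite scalerA.
Qed.
End Multilinear.

Lemma sum_bool_pair (V : nmodType) (I : finType) (F : bool * I -> V) :
  \sum_c F c = \sum_i F (true, i) + \sum_i F (false, i).
Proof.
rewrite (eq_bigr (fun c => F (c.1, c.2))) => [|[] //].
by rewrite -(pair_bigA _ (fun s i => F (s, i))) big_bool.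
Qed.

Section Stationarity.
Context {R : realType} {n l m p : nat}.
Variables (P : mpcc R n l m p) (xbar : 'rV[R]_n).

Lemma weak_stationarity_interpolate x (lambda : {ffun 'I_p -> bool} -> 'rV[R]_l)
    (eta : {ffun 'I_p -> bool} -> 'rV[R]_m) (mu nu : {ffun 'I_p -> bool} -> 'rV[R]_p) :
  unit_cube x ->
  (forall beta, weak_stationarity P xbar (lambda beta) (eta beta) (mu beta) (nu beta)) ->
  weak_stationarity P xbar (interpolate lambda x) (interpolate eta x)
    (interpolate mu x) (interpolate nu x).
Proof.
move=> x01 ws; split.
- rewrite !interpolate_comb -[gradient _ _]scale1r -(weight_sum x) scaler_suml.
  rewrite -!big_split -!sumrB big1 // => b _ /=; have [E _ _ _ _] := ws b.
  by rewrite -!scalerDr -!scalerBr E scaler0.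
- by move=> i iI; apply: interpolate_ge0 => // b _; have [_ + _ _ _] := ws b; apply.
- by move=> i iI; apply: interpolate_eq0 => b; have [_ _ + _ _] := ws b; apply.
- by move=> i iI; apply: interpolate_eq0 => b; have [_ _ _ + _] := ws b; apply.
- by move=> i iI; apply: interpolate_eq0 => b; have [_ _ _ _ +] := ws b; apply.
Qed.

Lemma A_stationary_P_stationary :
  (forall alpha : {ffun 'I_p -> bool}, A_stationary P alpha xbar) ->
  forall alpha : {ffun 'I_p -> bool}, P_stationary P alpha xbar.
Proof.
move=> As alpha; split; first exact: (As alpha).1.
have /choice[lambda /choice[eta /choice[mu /choice[nu M]]]] := fun b => (As b).2.
(* [clip a b] vanishes exactly when [a = 0] or [a, b >= 0]; it is nonnegative
   when [a >= 0] and nonpositive when [b >= 0]. *)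
pose clip (a b : R) := Num.min a (Num.max (- b) 0).
have clip_cont (a b : 'rV[R]_p -> R) : continuous a -> continuous b ->
    continuous (fun x => clip (a x) (b x)).
  move=> ac bc x; apply: (@continuous_min _ _ a (fun x => Num.max (- b x) 0)); first exact: ac.
  apply: (@continuous_max _ _ (fun x => - b x) (fun=> 0)); last exact: cst_continuous.
  exact: (continuousN (bc x)).
have clip_ge0 a b : 0 <= a -> 0 <= clip a b by move=> a0; rewrite /clip le_min a0 le_max lexx orbT.
have clip_le0 a b : 0 <= b -> clip a b <= 0.
  by move=> b0; rewrite /clip ge_min ge_max oppr_le0 b0 lexx orbT.
have clip_eq0 a b : clip a b = 0 -> (0 <= a /\ 0 <= b) \/ a = 0.
  rewrite /clip; case: (leP a) => [_ ->|]; first by right.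
  move=> + /eqP; rewrite eq_le ge_max lexx andbT oppr_le0 => + /andP[b0 m0].
  by move=> /(le_lt_trans m0)/ltW; left.
pose mu_ := interpolate mu; pose nu_ := interpolate nu.
(* Exchanging the two multipliers reverses the signs of [clip] on the two faces; the minus sign
   restores them. *)
pose F i x : R := if i \in I00 P xbar then
  if alpha i then - clip (nu_ x 0 i) (mu_ x 0 i) else clip (mu_ x 0 i) (nu_ x 0 i)
  else 0.
have mu_ge0 i x : i \in I00 P xbar -> unit_cube x -> x 0 i = 0 -> 0 <= mu_ x 0 i.
  move=> iI x01 xi; apply: interpolate_ge0 => // b wb; have [_ + _] := M b; apply.
  rewrite inE iI; apply: contraNT wb => bi; apply/eqP/(@weight_eq0 _ _ _ _ i).
  by rewrite xi; case: (b i) bi.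
have nu_ge0 i x : i \in I00 P xbar -> unit_cube x -> x 0 i = 1 -> 0 <= nu_ x 0 i.
  move=> iI x01 xi; apply: interpolate_ge0 => // b wb; have [_ _ +] := M b; apply.
  rewrite inE iI; apply: contraNT wb => bi; apply/eqP/(@weight_eq0 _ _ _ _ i).
  by rewrite xi; case: (b i) bi.
have [i|i x x01 xi|i x x01 xi|x x01 Fx] := @poincare_miranda R p F.
- rewrite /F; case: (i \in I00 P xbar); last exact: cst_continuous.
  case: (alpha i) => x; last by apply: clip_cont; exact: interpolate_continuous.
  apply: (@continuousN _ _ _ (fun x => clip (nu_ x 0 i) (mu_ x 0 i))).
  by apply: clip_cont; exact: interpolate_continuous.
- rewrite /F; case: ifP => // iI; have := mu_ge0 i x iI x01 xi => m0.
  by case: (alpha i); [rewrite oppr_ge0 clip_le0|exact: clip_ge0].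
- rewrite /F; case: ifP => // iI; have := nu_ge0 i x iI x01 xi => m0.
  by case: (alpha i); [rewrite oppr_le0 clip_ge0|exact: clip_le0].
exists (interpolate lambda x), (interpolate eta x), (mu_ x), (nu_ x); split.
- by apply: weak_stationarity_interpolate => // b; have [] := M b.
- by move=> i; rewrite inE => /andP[iI /eqP ai]; have := Fx i; rewrite /F iI ai => /clip_eq0.
- move=> i; rewrite inE => /andP[iI /eqP ai]; have := Fx i; rewrite /F iI ai.
  by move=> /eqP; rewrite oppr_eq0 => /eqP/clip_eq0[[]|]; [left|right].
Qed.

Lemma GCQ_A_stationary : mpcc_differentiable P -> local_minimizer P xbar ->
  MPCC_GCQ P xbar -> forall alpha : {ffun 'I_p -> bool}, A_stationary P alpha xbar.
Proof.
move=> Pdiff [xfeas xmin] [_ gcq] alpha; split=> //.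
have [fdiff _ _ _ _] := Pdiff xbar.
(* The negative gradient lies in the polar of the tangent cone, which MPCC-GCQ identifies with that
   of the linearized cone. *)
have descent d : linearized_cone P xbar d -> 0 <= dotmul (gradient (mpcc_f P) xbar) d.
  have : polar_cone (tangent_cone (feasible P) xbar) (- gradient (mpcc_f P) xbar).
    by move=> y yT; rewrite dotmulNl oppr_le0; apply: tangent_cone_first_order yT.
  by rewrite gcq => /(_ d) + dL => /(_ dL); rewrite dotmulNl oppr_le0.
pose G0 i := (i \in I0p P xbar) || ((i \in I00 P xbar) && alpha i).
pose H0 i := (i \in Ip0 P xbar) || ((i \in I00 P xbar) && ~~ alpha i).
(* Generators of the polar of the branch of the linearized cone on which, for
   [i] in [I00], the derivative of [G_i] (if [alpha i]) or of [H_i] vanishes;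
   equality constraints appear with both signs. *)
pose a (c : 'I_l + bool * 'I_m + bool * 'I_p + bool * 'I_p) : 'rV[R]_n := match c with
  | inl (inl (inl i)) => - (i \in Ig P xbar)%:R *: gradientc (mpcc_g P) i xbar
  | inl (inl (inr (s, i))) => (-1) ^+ s *: gradientc (mpcc_h P) i xbar
  | inl (inr (s, i)) =>
      (if s then - (G0 i)%:R else (i \notin Ip0 P xbar)%:R) *: gradientc (mpcc_G P) i xbar
  | inr (s, i) =>
      (if s then - (H0 i)%:R else (i \notin I0p P xbar)%:R) *: gradientc (mpcc_H P) i xbar
  end.
have [d ad|c c0 E] := @farkas _ _ _ a (gradient (mpcc_f P) xbar).
  apply: descent.
  have adG0 i : i \notin Ip0 P xbar -> 0 <= dotmul (gradientc (mpcc_G P) i xbar) d.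
    by move=> iI; have := ad (inl (inr (false, i))); rewrite /= iI scale1r.
  have adG1 i : G0 i -> dotmul (gradientc (mpcc_G P) i xbar) d <= 0.
    by move=> iI; have := ad (inl (inr (true, i))); rewrite /= iI scaleN1r dotmulNl oppr_ge0.
  have adH0 i : i \notin I0p P xbar -> 0 <= dotmul (gradientc (mpcc_H P) i xbar) d.
    by move=> iI; have := ad (inr (false, i)); rewrite /= iI scale1r.
  have adH1 i : H0 i -> dotmul (gradientc (mpcc_H P) i xbar) d <= 0.
    by move=> iI; have := ad (inr (true, i)); rewrite /= iI scaleN1r dotmulNl oppr_ge0.
  split.
  - by move=> i iI; have := ad (inl (inl (inl i))); rewrite /= iI scaleN1r dotmulNl oppr_ge0.
  - move=> i; have := ad (inl (inl (inr (false, i)))); have := ad (inl (inl (inr (true, i)))).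
    rewrite /= expr1 expr0 scaleN1r scale1r dotmulNl oppr_ge0 => h1 h2.
    by apply/eqP; rewrite eq_le h1.
  - move=> i iI; apply/eqP; rewrite eq_le adG1 /G0 ?iI //= adG0 //.
    by move: iI; rewrite !inE => /andP[/eqP-> _]; rewrite ltxx.
  - move=> i iI; apply/eqP; rewrite eq_le adH1 /H0 ?iI //= adH0 //.
    by move: iI; rewrite !inE => /andP[_ /eqP->]; rewrite ltxx andbF.
  - move=> i iI; have /andP[/eqP Gi /eqP Hi] : (mpcc_G P xbar 0 i == 0) && (mpcc_H P xbar 0 i == 0).
      by move: iI; rewrite inE.
    have G_ge0 : 0 <= dotmul (gradientc (mpcc_G P) i xbar) d by rewrite adG0 // inE Gi ltxx.
    have H_ge0 : 0 <= dotmul (gradientc (mpcc_H P) i xbar) d by rewrite adH0 // inE Hi ltxx andbF.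
    split=> //; apply/eqP; rewrite mulf_eq0; apply/orP; case ai: (alpha i); [left|right].
      by rewrite eq_le G_ge0 adG1 // /G0 iI ai orbT.
    by rewrite eq_le H_ge0 adH1 // /H0 iI ai orbT.
(* Opposite generators merge into a multiplier of free sign; the indicators kill a multiplier that
   must vanish and leave a single nonnegative coefficient where a sign is required. *)
pose lambda : 'rV[R]_l := \row_i (c (inl (inl (inl i))) * (i \in Ig P xbar)%:R).
pose eta : 'rV[R]_m := \row_i (c (inl (inl (inr (true, i)))) - c (inl (inl (inr (false, i))))).
pose mu : 'rV[R]_p :=
  \row_i (c (inl (inr (false, i))) * (i \notin Ip0 P xbar)%:R - c (inl (inr (true, i))) * (G0 i)%:R).
pose nu : 'rV[R]_p :=
  \row_i (c (inr (false, i)) * (i \notin I0p P xbar)%:R - c (inr (true, i)) * (H0 i)%:R).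
exists lambda, eta, mu, nu; split; first split.
- rewrite E !big_sumType !sum_bool_pair /=.
  have -> : \sum_i lambda 0 i *: gradientc (mpcc_g P) i xbar =
      - \sum_i c (inl (inl (inl i))) *: a (inl (inl (inl i))).
    by rewrite -sumrN; apply: eq_bigr => i _; rewrite /= mxE scalerA -scaleNr mulrN opprK.
  have -> : \sum_i eta 0 i *: gradientc (mpcc_h P) i xbar =
      - (\sum_i c (inl (inl (inr (true, i)))) *: a (inl (inl (inr (true, i)))) +
         \sum_i c (inl (inl (inr (false, i)))) *: a (inl (inl (inr (false, i))))).
    rewrite -big_split -sumrN; apply: eq_bigr => i _ /=.
    by rewrite mxE !scalerA -scalerDl -scaleNr; congr (_ *: _); rewrite expr1 expr0; ring.
  have -> : \sum_i mu 0 i *: gradientc (mpcc_G P) i xbar =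
      \sum_i c (inl (inr (true, i))) *: a (inl (inr (true, i))) +
      \sum_i c (inl (inr (false, i))) *: a (inl (inr (false, i))).
    rewrite -big_split; apply: eq_bigr => i _ /=.
    by rewrite mxE !scalerA -scalerDl; congr (_ *: _); ring.
  have -> : \sum_i nu 0 i *: gradientc (mpcc_H P) i xbar =
      \sum_i c (inr (true, i)) *: a (inr (true, i)) +
      \sum_i c (inr (false, i)) *: a (inr (false, i)).
    rewrite -big_split; apply: eq_bigr => i _ /=.
    by rewrite mxE !scalerA -scalerDl; congr (_ *: _); ring.
  by do !move: (\sum_i _) => ?; apply/rowP => j; rewrite !mxE; ring.
- by move=> i iI; rewrite mxE mulr_ge0 ?c0.
- by move=> i /negbTE iI; rewrite mxE iI mulr0.
- move=> i iI; rewrite mxE /G0 iI mulr0 sub0r; move: iI; rewrite !inE => /andP[G_gt0 _].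
  by rewrite !(gt_eqF G_gt0) mulr0 oppr0.
- move=> i iI; rewrite mxE /H0 iI mulr0 sub0r; move: iI; rewrite !inE => /andP[_ H_gt0].
  by rewrite !(gt_eqF H_gt0) !andbF mulr0 oppr0.
- move=> i; rewrite !inE => /andP[/andP[/eqP Gi /eqP Hi] /eqP ai].
  by rewrite mxE /G0 !inE Gi Hi ai ltxx !andbF /= mulr0 subr0 mulr1.
- move=> i; rewrite !inE => /andP[/andP[/eqP Gi /eqP Hi] /eqP ai].
  by rewrite mxE /H0 !inE Gi Hi ai ltxx !andbF /= mulr0 subr0 mulr1.
Qed.
End Stationarity.

Theorem theorem3p4 (R : realType) (n l m p : nat) (P : mpcc R n l m p)
    (Pdiff : mpcc_differentiable P) (xbar : 'rV[R]_n)
    (xbar_feasible : feasible P xbar) :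
  ((forall alpha : {ffun 'I_p -> bool}, A_stationary P alpha xbar) ->
   (forall alpha : {ffun 'I_p -> bool}, P_stationary P alpha xbar))
  /\
  (local_minimizer P xbar -> MPCC_GCQ P xbar ->
   forall alpha : {ffun 'I_p -> bool}, P_stationary P alpha xbar).
Proof.
split=> [As|xmin gcq]; first exact: A_stationary_P_stationary.
by apply: A_stationary_P_stationary; exact: GCQ_A_stationary.
Qed.
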